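(* Let $D$ be an integral domain. Suppose that the polynomial ring $D[X]$ in one indeterminate over $D$ is a $w$-Hilbert domain. Then $w\text{-}\dim(D)=w\text{-}\dim(D[X])$.
   Context: Let $R$ be an integral domain with quotient field $F$ (applied to $R=D$ and $R=D[X]$). For a nonzero fractional ideal $I$ of $R$ put $I^{-1}=\{a\in F \mid aI\subseteq R\}$. A Glaz-Vasconcelos ideal (GV-ideal) of $R$ is a (nonzero) finitely generated ideal $J$ of $R$ with $J^{-1}=R$; the set of these is $\mathrm{GV}(R)$. The $w$-envelope of a nonzero fractional ideal $I$ is $I_w=\{a\in F \mid aJ\subseteq I \text{ for some } J\in \mathrm{GV}(R)\}$. An ideal $I$ of $R$ is a $w$-ideal if $I_w=I$; since the $w$-operation is defined only on nonzero fractional ideals, $w$-ideals are nonzero. A maximal $w$-ideal is a proper $w$-ideal that is not properly contained in any proper $w$-ideal; $w\text{-}\mathrm{Max}(R)$ is the set of maximal $w$-ideals of $R$. A prime $w$-ideal is an ideal that is both a prime ideal and a $w$-ideal (in particular, it is nonzero). $R$ is a $w$-Hilbert domain if every prime $w$-ideal of $R$ can be expressed as an intersection of maximal $w$-ideals of $R$. The $w$-dimension of $R$ is $w\text{-}\dim(R)=\sup\{\mathrm{ht}(M)\mid M\in w\text{-}\mathrm{Max}(R)\}$, where $\mathrm{ht}(M)$ is the height of the prime ideal $M$.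
   Formalization: The formal theorem assumes in addition that D is not a field; for a field D the claim fails, since D has no maximal w-ideal (so w-dim(D) is a supremum of the empty set, not 1) while D[X] is w-Hilbert with w-dim(D[X]) = 1. *)

(* Defs.v *)
From mathcomp Require Import all_boot all_order all_algebra.
From mathcomp Require Import boolp classical_sets constructive_ereal.

Set Implicit Arguments.
Unset Strict Implicit.
Unset Printing Implicit Defensive.

Import Order.TTheory GRing.Theory Num.Theory.

Local Open Scope classical_set_scope.
Local Open Scope ring_scope.

Section WOperation.
Variable R : idomainType.

Local Notation F := {fraction R}.
Local Notation "x %:F" := (@FracField.tofrac R x) : ring_scope.

(* Ideals are subsets of R, possibly zero or equal to R.  The predicate
   [idealr_closed] of ring_quotient also requires properness, hence the use of
   R-submodules of R here. *)
Definition ideal (I : set R) : Prop := @submod_closed R R^o (mem I).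

Definition prime_ideal (P : set R) : Prop :=
  idealr_closed (mem P) /\ prime_idealr_closed (mem P).

Definition ideal_gen (s : seq R) : set R :=
  [set x | exists c : 'I_(size s) -> R, x = \sum_(i < size s) c i * s`_i].

(* Fractional ideals are subsets of the quotient field; [in_frac I] is the
   ideal I of R seen there. *)
Definition in_frac (I : set R) : set F := [set x%:F | x in I].

Definition inv_frac (I : set F) : set F :=
  [set a | forall x, I x -> in_frac [set: R] (a * x)].

Definition GV (J : set R) : Prop :=
  [/\ exists s : seq R, J = ideal_gen s,
      J <> [set 0] &
      inv_frac (in_frac J) = in_frac [set: R]].

Definition w_env (I : set F) : set F :=
  [set a | exists2 J, GV J & forall x, J x -> I (a * x%:F)].

Definition w_ideal (I : set R) : Prop :=
  [/\ ideal I, I <> [set 0] & w_env (in_frac I) = in_frac I].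

Definition w_Max : set (set R) :=
  [set M | [/\ w_ideal M, M <> [set: R] &
    forall N, w_ideal N -> N <> [set: R] -> ~ (M `<` N)]].

Definition w_Hilbert : Prop :=
  forall P, prime_ideal P -> w_ideal P ->
    exists2 S : set (set R), S `<=` w_Max & P = \bigcap_(M in S) M.

Definition prime_chain (n : nat) (P : set R) : Prop :=
  exists C : nat -> set R,
    [/\ forall i, (i <= n)%N -> prime_ideal (C i),
        forall i, (i < n)%N -> C i `<` C i.+1 &
        C n = P].

(* Heights and dimensions live in {0, 1, 2, ...} and +oo, inside \bar int,
   where every set of such values has a supremum; the empty set gets 0. *)
Definition height (P : set R) : \bar int :=
  supremum 0%E [set n%:Z%:E | n in [set n | prime_chain n P]].

Definition w_dim : \bar int := supremum 0%E [set height M | M in w_Max].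

End WOperation.

(* Main.v *)
(** Maximal w-ideals of D[X] are either extensions M[X] of maximal w-ideals M of
    D or uppers to zero (nonzero primes meeting D in 0), and the latter have
    height 1.  If D[X] is w-Hilbert, no upper to zero Q lies in such an M[X]:
    Q is an intersection of maximal w-ideals, not all of them extensions
    because Q meets D in 0, hence Q is itself a maximal w-ideal.  By Krull's
    theorem on primes disjoint from a multiplicative set, every nonzero f then
    divides some d t with d in D nonzero and t outside M[X].

    Let Q be any prime inside M[X] and P its contraction.  If f in Q is outside
    P[X] and of least degree, its leading coefficient c is not in P;
    pseudo-dividing t by f, the remainder is a multiple of f over the fraction
    field, hence 0, so c^n t is a multiple of f and lies in Q, and t is in
    Q, a contradiction.  So Q = P[X], chains of primes below M[X] are
    extensions of chains below M, and M and M[X] have the same height.  The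
    uppers to zero do not matter, as w-dim D is at least 1. *)
Require Import Defs.
From mathcomp Require Import all_boot all_order all_algebra.
From mathcomp Require Import boolp classical_sets constructive_ereal.

Set Implicit Arguments.
Unset Strict Implicit.
Unset Printing Implicit Defensive.

Import Order.TTheory GRing.Theory Num.Theory.

Local Open Scope classical_set_scope.
Local Open Scope ring_scope.

(** * Zorn's lemma above a given set *)

Lemma Zorn_above (T : Type) (Good : set (set T)) (I : set T) : Good I ->
  (forall F : set (set T), F `<=` Good -> F !=set0 -> total_on F subset ->
     Good (\bigcup_(X in F) X)) ->
  exists A, [/\ I `<=` A, Good A & forall B, A `<=` B -> Good B -> B `<=` A].
Proof.
move=> goodI goodU.
pose P : set (set T) := [set A | A = set0 \/ (I `<=` A /\ Good A)].
have [F subF totF|A [PA maxA]] := @Zorn_bigcup T P.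
  pose G := F `&` [set A | A !=set0].
  have UG : \bigcup_(X in F) X = \bigcup_(X in G) X.
    apply/seteqP; split=> x [X FX Xx]; exists X => //; last by case: FX.
    by split=> //; exists x.
  have [[X GX]|G0] := pselect (G !=set0); last first.
    left; rewrite UG -subset0 => x [X GX _]; by apply: G0; exists X.
  have GP Y : G Y -> I `<=` Y /\ Good Y.
    by move=> [/subF[-> [x]//|]].
  right; rewrite UG; split.
    by move=> x Ix; exists X => //; exact: (GP _ GX).1.
  apply: goodU; [by move=> Y /GP[] | by exists X|].
  by move=> Y Z [FY _] [FZ _]; exact: totF.
have IA_good : I `<=` A /\ Good A.
  case: PA => [A0|//]; have [I0|/set0P I0] := eqVneq I set0.
    by rewrite A0; split; [rewrite I0|rewrite -I0].
  exfalso; apply: (maxA I); last by right; split.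
  by rewrite A0; split=> //; case: I0 => x Ix /(_ x Ix).
case: IA_good => IA goodA; exists A; split=> // B AB goodB.
apply: contrapT => nBA; apply: (maxA B) => //.
by right; split=> //; exact: subset_trans AB.
Qed.

(** * Ideals, and prime ideals obtained from Zorn's lemma *)

Section Ideals.
Variable R : idomainType.
Implicit Types (I P : set R) (s t : seq R).

Lemma idealP I :
  ideal I <-> I 0 /\ forall a u v, I u -> I v -> I (a * u + v).
Proof.
rewrite /ideal /GRing.submod_closed; split=> -[I0 I_lin].
  split; first by move: I0; rewrite inE.
  by move=> a u v Iu Iv; have := I_lin a u v; rewrite !inE; apply.
by split=> [|a u v]; rewrite !inE //; exact: I_lin.
Qed.

Lemma prime_idealP P :
  prime_ideal P <->
  [/\ ideal P, ~ P 1 & forall u v, P (u * v) -> P u \/ P v].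
Proof.
split=> [[[P0 P1 P_lin] P_prime]|[/idealP[P0 P_lin] P1 P_prime]].
  split.
  - apply/idealP; split; first by move: P0; rewrite inE.
    by move=> a u v Pu Pv; have := P_lin a u v; rewrite !inE; apply.
  - by move: P1; rewrite notin_setE.
  - move=> u v Puv; have := P_prime u v; rewrite !inE => /(_ Puv).
    by move=> /orP[]/asboolP; auto.
split; first by split=> [||a u v]; rewrite ?inE ?notin_setE //; exact: P_lin.
move=> u v; rewrite !inE => /P_prime[?|?]; apply/orP; [left|right]; exact/asboolP.
Qed.

Lemma prime_is_ideal P : prime_ideal P -> ideal P.
Proof. by case/prime_idealP. Qed.

Lemma ideal0 I : ideal I -> I 0.
Proof. by case/idealP. Qed.

Lemma ideal_mull I a x : ideal I -> I x -> I (a * x).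
Proof. by case/idealP=> I0 /(_ a x 0) + Ix; rewrite addr0; apply. Qed.

Lemma ideal_mulr I a x : ideal I -> I x -> I (x * a).
Proof. by rewrite mulrC; exact: ideal_mull. Qed.

Lemma ideal_add I x y : ideal I -> I x -> I y -> I (x + y).
Proof. by case/idealP=> _ /(_ 1 x y); rewrite mul1r. Qed.

Lemma ideal_sub I x y : ideal I -> I x -> I y -> I (x - y).
Proof.
by move=> idI Ix Iy; rewrite addrC -mulN1r; move/idealP: idI => [_]; apply.
Qed.

Lemma nonzero_elt I : ideal I -> I <> [set 0] -> exists2 x, I x & x != 0.
Proof.
move=> idI I0; apply: contrapT => nex; apply: I0.
apply/seteqP; split=> [x Ix|_ ->].
  by apply/eqP; apply: contrapT => /negP x0; apply: nex; exists x.
exact: ideal0.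
Qed.

Lemma ideal_set0 : ideal ([set 0] : set R).
Proof. by apply/idealP; split=> // a _ _ -> ->; rewrite mulr0 addr0. Qed.

Lemma ideal_sum I (J : Type) (r : seq J) (f : J -> R) :
  ideal I -> (forall j, I (f j)) -> I (\sum_(j <- r) f j).
Proof.
move=> idI If; elim/big_ind: _ => //; first exact: ideal0.
by move=> x y; exact: ideal_add.
Qed.

Lemma ideal_ideal_gen s : ideal (ideal_gen s).
Proof.
apply/idealP; split.
  by exists (fun=> 0); rewrite big1 // => i _; rewrite mul0r.
move=> a _ _ [c ->] [d ->]; exists (fun i => a * c i + d i).
by rewrite mulr_sumr -big_split; apply: eq_bigr => i _; rewrite mulrDl mulrA.
Qed.

Lemma mem_ideal_gen s x : x \in s -> ideal_gen s x.
Proof.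
move=> xs; have lt_xs : (index x s < size s)%N by rewrite index_mem.
exists (fun i => (i == Ordinal lt_xs)%:R).
rewrite (bigD1 (Ordinal lt_xs)) //= eqxx mul1r nth_index // big1 ?addr0 //.
by move=> i /negPf->; rewrite mul0r.
Qed.

Lemma ideal_gen_min I s :
  ideal I -> (forall x, x \in s -> I x) -> ideal_gen s `<=` I.
Proof.
move=> idI sI _ [c ->]; apply: ideal_sum => // i.
by apply: ideal_mull => //; exact/sI/mem_nth.
Qed.

Definition add_elt I x : set R :=
  [set y | exists2 b, I b & exists r, y = b + r * x].

Lemma ideal_add_elt I x : ideal I -> ideal (add_elt I x).
Proof.
move=> idI; apply/idealP; split.
  by exists 0; [exact: ideal0|exists 0; rewrite mul0r addr0].
move=> a _ _ [b Ib [r ->]] [c Ic [q ->]]; exists (a * b + c).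
  by apply: ideal_add => //; exact: ideal_mull.
exists (a * r + q); rewrite mulrDr !mulrDl !mulrA; exact: addrACA.
Qed.

Lemma sub_add_elt I x : I `<=` add_elt I x.
Proof. by move=> y Iy; exists y => //; exists 0; rewrite mul0r addr0. Qed.

Lemma mem_add_elt I x : ideal I -> add_elt I x x.
Proof. by move=> /ideal0 I0; exists 0 => //; exists 1; rewrite mul1r add0r. Qed.

(* A common generalization of Krull's theorem on primes disjoint from a
   multiplicative set (singletons) and of the existence of maximal w-ideals
   (generators of GV-ideals). *)
Lemma max_avoiding_prime (G : set (seq R)) I :
  G [:: 1] -> (forall s t, G s -> G t -> G [seq x * y | x <- s, y <- t]) ->
  ideal I -> (forall s, G s -> exists2 x, x \in s & ~ I x) ->
  exists P, [/\ I `<=` P, prime_ideal P,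
    forall s, G s -> exists2 x, x \in s & ~ P x &
    forall B, P `<=` B -> ideal B ->
      (forall s, G s -> exists2 x, x \in s & ~ B x) -> B `<=` P].
Proof.
move=> G1 GM idI avI.
pose Good A := ideal A /\ forall s, G s -> exists2 x, x \in s & ~ A x.
have [||P [IP [idP avP] maxP]] := @Zorn_above R Good I; first by [].
  move=> F FG [X0 FX0] totF; split.
    apply/idealP; split; first by exists X0 => //; exact: ideal0 (FG _ FX0).1.
    move=> a u v [X FX Xu] [Y FY Yv].
    have [Z [FZ Zu Zv]] : exists Z, [/\ F Z, Z u & Z v].
      by have [XY|YX] := totF _ _ FX FY; [exists Y|exists X]; split=> //; auto.
    exists Z => //; apply: ideal_add; rewrite //; try exact: (FG _ FZ).1.
    by apply: ideal_mull => //; exact: (FG _ FZ).1.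
  move=> s Gs; apply: contrapT => nex.
  have sU x : x \in s -> exists2 X, F X & X x.
    by move=> xs; apply: contrapT => nX; apply: nex; exists x => // -[X]; eauto.
  (* As [s] is finite and the chain total, one member contains all of [s], although it avoids
     [s]. *)
  have [X FX sX] : exists2 X, F X & forall x, x \in s -> X x.
    elim: s sU {Gs nex} => [|x s IHs] sU; first by exists X0.
    have [X FX sX] : exists2 X, F X & forall x, x \in s -> X x.
      by apply: IHs => y ys; apply: sU; rewrite inE ys orbT.
    have [Y FY Yx] := sU x (mem_head _ _).
    have [XY|YX] := totF _ _ FX FY; [exists Y|exists X] => // y; rewrite inE.
      by move=> /orP[/eqP->//|/sX/XY].
    by move=> /orP[/eqP->|/sX//]; exact: YX.
  by have [x xs nXx] := (FG _ FX).2 _ Gs; exact/nXx/sX.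
exists P; split=> //; last by move=> B PB idB avB; exact: maxP.
apply/prime_idealP; split=> //.
  by move=> P1; have [x] := avP _ G1; rewrite inE => /eqP->.
(* By maximality, P + Rx must swallow some member of [G] whole. *)
have bigger x : ~ P x -> exists2 s, G s & forall y, y \in s -> add_elt P x y.
  move=> nPx; apply: contrapT => nex; apply/nPx/(maxP (add_elt P x)).
  - exact: sub_add_elt.
  - split; first exact: ideal_add_elt.
    move=> s Gs; apply: contrapT => nav; apply: nex; exists s => // y ys.
    by apply: contrapT => nPy; apply: nav; exists y.
  - exact: mem_add_elt.
move=> x y Pxy; apply: contrapT => /not_orP[/bigger[s Gs sP] /bigger[t Gt tP]].
(* Every product (b + r x)(c + q y) lies in [P], since b, c and x y do; yet [P] avoids the product
   sequence. *)
have [_ /allpairsP[[u v] /= [us vt ->]]] := avP _ (GM _ _ Gs Gt).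
have [b Pb [r ->]] := sP _ us; have [c Pc [q ->]] := tP _ vt; apply.
rewrite mulrDl; apply: (ideal_add idP); first exact: ideal_mulr.
rewrite mulrDr; apply: (ideal_add idP); first exact: ideal_mull.
by rewrite mulrACA; exact: ideal_mull.
Qed.

End Ideals.

(** * GV-ideals through their generators, and maximal w-ideals *)

Section GVSequences.
Variable R : idomainType.
Implicit Types (I J M N P : set R) (s t : seq R).

Definition divides (q p : R) := exists r, p = q * r.

(** Says that [s] generates a GV-ideal, without fractions: p/q lies in the inverse iff [q] divides
    [p * x] for all generators [x]. *)
Definition gv_seq s :=
  (exists2 x, x \in s & x != 0) /\
  forall q p, q != 0 -> (forall x, x \in s -> divides q (p * x)) -> divides q p.

(** For a nonzero prime ideal this is equivalent to being a w-ideal. *)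
Definition avoids_gv I := forall s, gv_seq s -> exists2 x, x \in s & ~ I x.

Local Notation "x %:F" := (@FracField.tofrac R x) : ring_scope.

Lemma frac_numden (a : {fraction R}) :
  exists p q : R, q != 0 /\ a = p%:F / q%:F.
Proof.
elim/generic_quotient.quotW: a => r.
exists (frac r).1, (frac r).2; split; first exact: denom_ratioP.
have d0 := denom_ratioP r; apply: (mulIf (x := ((frac r).2)%:F)).
  by rewrite tofrac_eq0.
rewrite divfK ?tofrac_eq0 //; unlock FracField.tofrac.
rewrite -[LHS]FracField.pi_mul; apply/eqP.
rewrite FracField.equivf_def /FracField.mulf.
by rewrite !numden_Ratio ?mulr1 ?oner_eq0 // mulrC.
Qed.

Lemma in_frac_div (I : set R) p q :
  q != 0 -> in_frac I (p%:F / q%:F) <-> exists2 r, I r & p = q * r.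
Proof.
move=> q0; have qF0 : q%:F != 0 by rewrite tofrac_eq0.
split=> [[r Ir /(congr1 (fun z => z * q%:F))]|[r Ir ->]]; last first.
  by exists r => //; rewrite tofracM mulrAC divff // mul1r.
rewrite divfK // -tofracM => /eqP; rewrite tofrac_eq => /eqP <-.
by exists r; rewrite // mulrC.
Qed.

(** The elements x such that q divides p x form an ideal, so divisibility may be tested on
    generators. *)
Lemma GVP J : GV J <-> exists2 s, J = ideal_gen s & gv_seq s.
Proof.
have div_ideal q p : ideal [set x : R | divides q (p * x)].
  apply/idealP; split; first by exists 0; rewrite !mulr0.
  move=> a u v [x ex] [y ey]; exists (a * x + y).
  by rewrite !mulrDr mulrCA ex ey mulrCA.
split=> [[[s ->] Jn0 Jinv]|[s -> [[x xs x0] s_div]]].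
  exists s => //; split.
    apply: contrapT => s0; apply: Jn0; apply/seteqP; split=> [|_ ->]; last first.
      exact: ideal0 (ideal_ideal_gen s).
    apply: (ideal_gen_min (ideal_set0 R)) => x xs.
    have [//|x0] := eqVneq x 0.
    by case: s0; exists x.
  move=> q p q0 qp; suff: in_frac [set: R] (p%:F / q%:F).
    by move/(in_frac_div _ _ q0) => [r _]; exists r.
  rewrite -Jinv => _ [x sx <-].
  have [r e] := ideal_gen_min (div_ideal q p) qp sx.
  by rewrite mulrAC -tofracM; apply/in_frac_div => //; exists r.
split; first by exists s.
  by move=> J0; move: (mem_ideal_gen xs); rewrite J0 => /eqP; rewrite (negPf x0).
apply/seteqP; split=> a; last first.
  by move=> [b _ <-] _ [y _ <-]; exists (b * y); rewrite ?tofracM.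
have [p [q [q0 ->]]] := frac_numden a => pq_inv.
suff [r er] : divides q p by apply/in_frac_div => //; exists r.
apply: s_div => // y ys.
have := pq_inv (y%:F) (ex_intro2 _ _ y (mem_ideal_gen ys) erefl).
by rewrite mulrAC -tofracM => /in_frac_div-/(_ q0)[r _]; exists r.
Qed.

Lemma gv_seq1 : gv_seq [:: 1].
Proof.
split; first by exists 1; rewrite ?mem_head ?oner_neq0.
by move=> q p q0 /(_ 1 (mem_head _ _)); rewrite mulr1.
Qed.

Lemma gv_seqM s t : gv_seq s -> gv_seq t -> gv_seq [seq x * y | x <- s, y <- t].
Proof.
move=> [[x xs x0] s_div] [[y yt y0] t_div]; split.
  by exists (x * y); [exact: allpairs_f|rewrite mulf_neq0].
move=> q p q0 qp; apply: s_div => // u us; apply: t_div => // v vt.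
by rewrite -mulrA; apply/qp/allpairs_f.
Qed.

(** A GV-ideal inside [I] would put 1 in the w-envelope, which is [I]. *)
Lemma w_ideal_avoids_gv I : w_ideal I -> I <> [set: R] -> avoids_gv I.
Proof.
move=> [idI I0 wI] IT s gv_s; apply: contrapT => nex; apply: IT.
have : w_env (in_frac I) (1%:F).
  exists (ideal_gen s); first by apply/GVP; exists s.
  move=> x sx; exists x; last by rewrite -tofracM mul1r.
  apply: (ideal_gen_min idI _ sx) => y ys.
  by apply: contrapT => nIy; apply: nex; exists y.
rewrite wI => -[y Iy /eqP]; rewrite tofrac_eq => /eqP y1.
apply/seteqP; split=> // x _.
by rewrite -[x]mulr1; apply: ideal_mull; rewrite // -y1.
Qed.

(** If aJ lies in [P] with J a GV-ideal, then a is in R, and an element of J outside [P] forces a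
    into [P]. *)
Lemma prime_w_ideal P :
  prime_ideal P -> P <> [set 0] -> avoids_gv P -> w_ideal P.
Proof.
move=> primeP P0 avP; have /prime_idealP[idP P1 P_prime] := primeP.
split=> //; apply/seteqP; split=> a; last first.
  move=> [x Px <-]; exists (ideal_gen [:: 1]).
    by apply/GVP; exists [:: 1] => //; exact: gv_seq1.
  by move=> y _; exists (x * y); [exact: ideal_mulr|rewrite tofracM].
have [p [q [q0 ->]]] := frac_numden a.
move=> [_ /GVP[s -> gv_s] pqP].
have pP x : x \in s -> exists2 r, P r & p * x = q * r.
  move=> xs; have := pqP _ (mem_ideal_gen xs).
  by rewrite mulrAC -tofracM => /in_frac_div; apply.
apply/in_frac_div => //.
have [r er] : divides q p.
  by apply: gv_s.2 => // x /pP[r _ ->]; exists r.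
exists r => //; have [x xs nPx] := avP _ gv_s.
have [r' Pr'] := pP _ xs; rewrite er -mulrA => /(mulfI q0) e.
by case: (P_prime r x) => //; rewrite e.
Qed.

(** An ideal above [I] that is maximal among those containing no GV-ideal is prime, hence a w-ideal;
    proper w-ideals contain no GV-ideal either, so it is maximal among them. *)
Lemma sub_w_Max I : ideal I -> I <> [set 0] -> avoids_gv I ->
  exists M, [/\ w_Max M, prime_ideal M, avoids_gv M & I `<=` M].
Proof.
move=> idI I0 avI.
have [M [IM primeM avM maxM]] := max_avoiding_prime gv_seq1 gv_seqM idI avI.
have wM : w_ideal M.
  apply: prime_w_ideal => // M0; apply: I0; apply/seteqP; split=> [|_ ->].
    by rewrite -M0.
  exact: ideal0.
exists M; split=> //; split=> // [MT|N wN NT [MN]].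
  by have /prime_idealP[_ + _] := primeM; rewrite MT; apply.
apply; apply: maxM => //; first by case: wN.
exact: w_ideal_avoids_gv.
Qed.

Lemma w_Max_avoids_gv M : w_Max M -> avoids_gv M.
Proof. by case=> wM MT _; exact: w_ideal_avoids_gv. Qed.

Lemma w_Max_eq M N : w_Max M -> w_Max N -> M `<=` N -> M = N.
Proof.
move=> [_ _ maxM] [wN NT _] MN; apply: contrapT => neMN.
apply: (maxM N wN NT); split=> // NM; exact/neMN/seteqP.
Qed.

Lemma w_Max_prime M : w_Max M -> prime_ideal M.
Proof.
move=> maxM; have [[idM M0 _] _ _] := maxM.
have [N [maxN primeN _ MN]] := sub_w_Max idM M0 (w_Max_avoids_gv maxM).
by rewrite (w_Max_eq maxM maxN MN).
Qed.

End GVSequences.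

(** Lets the lemmas on ideals serve as rules for divisibility. *)
Lemma ideal_divides (R : idomainType) (q : R) : ideal [set p | divides q p].
Proof.
apply/idealP; split; first by exists 0; rewrite mulr0.
by move=> a _ _ [x ->] [y ->]; exists (a * x + y); rewrite mulrDr mulrCA.
Qed.

(** * Extension and contraction between D and D[X], uppers to zero *)

Section PolynomialIdeals.
Variable D : idomainType.
Implicit Types (I M : set D) (N Q : set {poly D}) (f g h : {poly D}).

Definition extension I : set {poly D} := [set f | forall i, I f`_i].

Definition contraction Q : set D := [set d | Q d%:P].

Lemma ideal_extension I : ideal I -> ideal (extension I).
Proof.
move=> idI; apply/idealP; split; first by move=> i; rewrite coef0; exact: ideal0.
move=> a u v Iu Iv i; rewrite coefD coefM; apply: ideal_add => //.
by apply: ideal_sum => // j; exact: ideal_mull.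
Qed.

Lemma ideal_contraction Q : ideal Q -> ideal (contraction Q).
Proof.
move=> idQ; apply/idealP; split; first exact: (ideal0 idQ).
move=> a u v Qu Qv; rewrite /contraction /= polyCD polyCM.
by apply: ideal_add => //; exact: ideal_mull.
Qed.

Lemma contraction_extension I : ideal I -> contraction (extension I) = I.
Proof.
move=> idI; apply/seteqP; split=> [x /(_ 0%N)|x Ix i]; rewrite coefC ?eqxx //.
by case: ifP => // _; exact: ideal0.
Qed.

Lemma extension_contraction Q : ideal Q -> extension (contraction Q) `<=` Q.
Proof.
move=> idQ f Qf; rewrite -[f]coefK poly_def; apply: ideal_sum => // i.
by rewrite -mul_polyC; exact: (ideal_mulr _ idQ (Qf i)).
Qed.

(** Gauss's argument: if i and j are the least indices of coefficients of f and g outside [I], the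
    coefficient of f g at i + j is f_i g_j modulo [I]. *)
Lemma prime_extension I : prime_ideal I -> prime_ideal (extension I).
Proof.
move=> /prime_idealP[idI I1 I_prime]; apply/prime_idealP; split.
- exact: ideal_extension.
- by move=> /(_ 0%N); rewrite coef1.
move=> f g fgI; apply: contrapT => /not_orP[].
have least h : ~ extension I h ->
    exists n, ~ I h`_n /\ forall m, (m < n)%N -> I h`_m.
  move=> /existsNP[n0 hn0]; have ex : exists n, ~~ `[< I h`_n >].
    by exists n0; apply/asboolPn.
  case: (ex_minnP ex) => n /asboolPn hn minn; exists n; split=> // m mn.
  apply: contrapT => /asboolPn/minn; by rewrite leqNgt mn.
move=> /least[i [fi If]] /least[j [gj Ig]].
suff /I_prime[] : I (f`_i * g`_j) by [].
have lt_i : (i < (i + j).+1)%N by rewrite ltnS leq_addr.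
have := fgI (i + j)%N; rewrite coefM (bigD1 (Ordinal lt_i)) //= addKn.
set S := \sum_(_ < _ | _) _ => sumI.
rewrite -[X in I X](addrK S); apply: (ideal_sub idI) => //.
rewrite /S; apply: (big_ind I) => [|x y|k neki]; first exact: ideal0.
  exact: ideal_add.
have [lt_ki|le_ik] := ltnP k i; first by apply: ideal_mulr => //; exact: If.
apply: ideal_mull => //; apply: Ig.
have le_k : (k <= i + j)%N by rewrite -ltnS.
rewrite -(ltn_add2r k) subnK // [X in (_ < X)%N]addnC ltn_add2r.
by rewrite ltn_neqAle le_ik andbT eq_sym.
Qed.

Lemma prime_contraction Q : prime_ideal Q -> prime_ideal (contraction Q).
Proof.
move=> /prime_idealP[idQ Q1 Q_prime]; apply/prime_idealP; split=> //.
  exact: ideal_contraction.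
by move=> u v; rewrite /contraction /= polyCM; exact: Q_prime.
Qed.

Lemma prime_exp Q f n : prime_ideal Q -> Q (f ^+ n) -> Q f.
Proof.
move=> /prime_idealP[_ Q1 Q_prime]; elim: n => [//|n IHn].
by rewrite exprS => /Q_prime[].
Qed.

Lemma min_size (A : set {poly D}) f : A f ->
  exists2 f0, A f0 & forall g, A g -> (size f0 <= size g)%N.
Proof.
move=> Af; have ex : exists n, `[< exists2 g, A g & size g = n >].
  by exists (size f); apply/asboolP; exists f.
case: (ex_minnP ex) => n /asboolP[f0 Af0 <-] minf0; exists f0 => // g Ag.
by apply: minf0; apply/asboolP; exists g.
Qed.

Lemma size_sub_lead_term f : f != 0 ->
  (size (f - (lead_coef f)%:P * 'X^((size f).-1))%R < size f)%N.
Proof.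
rewrite -size_poly_gt0; move/prednK=> sf; rewrite -{2}sf ltnS.
apply/leq_sizeP => j le_j; rewrite coefB coefCM coefXn.
have [->|ne_j] := eqVneq j _; first by rewrite mulr1 subrr.
by rewrite mulr0 subr0 nth_default // -sf ltn_neqAle le_j eq_sym ne_j.
Qed.

Definition upper_to_zero Q :=
  [/\ prime_ideal Q, Q <> [set 0] & forall d, Q d%:P -> d = 0].

(* Over the fraction field, an upper to zero is generated by any of its
   nonzero elements of least degree. *)
Lemma upper_to_zero_gen Q : upper_to_zero Q ->
  exists f, [/\ Q f, (1 < size f)%N,
    forall g, Q g -> g != 0 -> (size f <= size g)%N &
    forall g, Q g -> exists n, divides f ((lead_coef f ^+ n)%:P * g)].
Proof.
move=> [primeQ Qn0 Q0]; have idQ := prime_is_ideal primeQ.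
have [f1 Qf1 f1n0] := nonzero_elt idQ Qn0.
have [f [Qf f0] minf] := @min_size [set f | Q f /\ f != 0] _ (conj Qf1 f1n0).
exists f; split=> // [|g Qg g0|g Qg].
- rewrite ltnNge; apply: contra f0 => /size1_polyC fC.
  by move: Qf; rewrite fC => /Q0 ->.
- exact: minf.
(* Pseudo-division by [f]: the remainder lies in [Q] and is smaller than [f], hence is 0. *)
exists (scalp g f), (g %/ f)%R; rewrite mul_polyC Pdiv.Idomain.divp_eq.
rewrite mulrC; suff -> : (g %% f)%R = 0 by rewrite addr0.
apply/eqP; apply: contraT => r0.
have := ltn_modpN0 g f0; rewrite ltnNge minf //; split=> //.
have -> : (g %% f)%R = (lead_coef f ^+ scalp g f)%:P * g - (g %/ f)%R * f.
  by rewrite mul_polyC Pdiv.Idomain.divp_eq addrAC subrr add0r.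
by apply: ideal_sub => //; exact: ideal_mull.
Qed.

(** This is the height 1 property. With f and g of least degree in [N] and [Q], some c^n g is f h;
    here h has smaller degree than g, so it is not in [Q] and f is. Every p in [N] then has a
    nonzero constant multiple in [Q]. *)
Lemma upper_to_zero_eq Q N : prime_ideal Q -> Q <> [set 0] ->
  upper_to_zero N -> Q `<=` N -> Q = N.
Proof.
move=> primeQ Qn0 upN QN; have /prime_idealP[idQ Q1 Q_prime] := primeQ.
have Q0 d : Q d%:P -> d = 0 by move=> /QN; case: upN => _ _; apply.
have [f [Nf sf minf divf]] := upper_to_zero_gen upN.
have f0 : f != 0 by rewrite -size_poly_gt0 ltnW.
have lf n : lead_coef f ^+ n != 0 by rewrite expf_neq0 ?lead_coef_eq0.
have [g [Qg sg ming divg]] := upper_to_zero_gen (And3 primeQ Qn0 Q0).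
have g0 : g != 0 by rewrite -size_poly_gt0 ltnW.
have Qf : Q f.
  have [n [h eh]] := divf g (QN _ Qg).
  have [//|Qh] : Q f \/ Q h by apply: Q_prime; rewrite -eh; exact: ideal_mull.
  have h0 : h != 0.
    apply: contra_eq_neq eh => ->.
    by rewrite mulr0 mulf_neq0 // polyC_eq0.
  have := ming h Qh h0.
  have := congr1 (fun p : {poly D} => size p) eh.
  rewrite mul_polyC size_scale // size_mul // => ->.
  by case: (size f) sf => [|[|k]] //= _; rewrite addSn ltnNge leq_addl.
apply/seteqP; split=> // p Np; have [n [h eh]] := divf p Np.
have : Q ((lead_coef f ^+ n)%:P * p) by rewrite eh; exact: ideal_mulr.
by move=> /Q_prime[|//] /Q0/eqP; rewrite (negPf (lf n)).
Qed.

(** Otherwise [f] of least degree divides c^n x for all x in [s], with a common n, so it divides the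
    nonzero constant c^n although its degree is positive. *)
Lemma upper_to_zero_avoids_gv Q : upper_to_zero Q -> avoids_gv Q.
Proof.
move=> upQ s gv_s; apply: contrapT => nex.
have sQ x : x \in s -> Q x.
  by move=> xs; apply: contrapT => nQx; apply: nex; exists x.
have [f [Qf sf minf divf]] := upper_to_zero_gen upQ.
have f0 : f != 0 by rewrite -size_poly_gt0 ltnW.
have [n sn] : exists n, forall x, x \in s ->
    divides f ((lead_coef f ^+ n)%:P * x).
  elim: s sQ {gv_s nex} => [|x s IHs] sQ; first by exists 0%N.
  have [n sn] : exists n, forall y, y \in s ->
      divides f ((lead_coef f ^+ n)%:P * y).
    by apply: IHs => y ys; apply: sQ; rewrite inE ys orbT.
  have [m xm] := divf x (sQ _ (mem_head _ _)).
  exists (n + m)%N => y; rewrite inE exprD polyCM => /orP[/eqP->|ys].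
    by rewrite -mulrA; apply: (ideal_mull _ (ideal_divides f)).
  rewrite mulrAC; apply: (ideal_mulr _ (ideal_divides f)); exact: sn.
have [h eh] := gv_s.2 _ _ f0 sn.
have h0 : h != 0.
  apply: contra_eq_neq eh => ->.
  by rewrite mulr0 polyC_eq0 expf_neq0 ?lead_coef_eq0.
have := size_polyC_leq1 (lead_coef f ^+ n); rewrite eh size_mul // leqNgt.
move: sf; rewrite -size_poly_gt0 in h0.
by case: (size f) (size h) h0 => [|[|k]] [|l] //= _ _; rewrite addnS.
Qed.

Lemma divides_polyC (q : D) f : divides q%:P f <-> forall i, divides q f`_i.
Proof.
split=> [[g ->] i|qf]; first by exists g`_i; rewrite coefCM.
have /choice[c ec] : forall i, exists r, f`_i = q * r by exact: qf.
exists (\poly_(i < size f) c i); apply/polyP => i; rewrite coefCM coef_poly.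
by case: ltnP => [_|/leq_sizeP/(_ i (leqnn i))->]; rewrite ?mulr0.
Qed.

(** Testing a GV-sequence of D[X] against constants shows that all its coefficients together form a
    GV-sequence of D; one of them is outside [I]. *)
Lemma extension_avoids_gv I : prime_ideal I -> avoids_gv I ->
  avoids_gv (extension I).
Proof.
move=> primeI avI s [[x xs x0] s_div]; apply: contrapT => nex.
have coef_in (y : {poly D}) i : y \in s -> y`_i != 0 ->
    y`_i \in flatten (map (@polyseq D) s).
  move=> ys yi0; apply/flatten_mapP; exists y => //.
  by apply: mem_nth; rewrite ltnNge; apply: contra yi0 => /(nth_default 0)->.
have [|c] := avI (flatten (map (@polyseq D) s)).
  split.
    by exists (lead_coef x); rewrite ?lead_coef_eq0 ?coef_in ?lead_coef_eq0.
  move=> q p q0 qp; suff /divides_polyC/(_ 0%N) : divides q%:P p%:P.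
    by rewrite coefC eqxx.
  apply: s_div => [|y ys]; first by rewrite polyC_eq0.
  apply/divides_polyC => i; rewrite coefCM.
  have [->|yi0] := eqVneq y`_i 0; first by exists 0; rewrite !mulr0.
  exact/qp/coef_in.
move=> /flatten_mapP[y ys /(nthP 0)[i _ <-]]; apply.
by apply: contrapT => nIy; apply: nex; exists y => // /(_ i).
Qed.

End PolynomialIdeals.

(** * Maximal w-ideals of D[X] containing a nonzero constant *)

Section MaximalWIdeals.
Variable D : idomainType.
Implicit Types (I M P : set D) (N Q : set {poly D}) (f g h : {poly D}).

(* McCoy's theorem over D/(a). *)
Lemma divides_mul_cancel (a : D) f h :
  (forall p, (forall i, divides a (p * f`_i)) -> divides a p) ->
  divides a%:P (f * h) -> divides a%:P h.
Proof.
move=> f_reg; have [n le_hn] := ubnP (size h).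
elim: n => // n IHn in h le_hn *; move=> afh.
have [->|h0] := eqVneq h 0; first exact: ideal0 (ideal_divides _).
set m := (size h).-1; have eh : size h = m.+1 by rewrite prednK ?size_poly_gt0.
have idaX := ideal_divides a%:P; have ida := ideal_divides a.
suff afih i : divides a%:P ((f`_i)%:P * h).
  apply/divides_polyC => k; apply: f_reg => i; rewrite mulrC.
  by have /divides_polyC/(_ k) := afih i; rewrite coefCM.
(* Descending induction on [i], with [d] bounding the distance to [size f]. *)
have [d le_d] : exists d, (size f <= i + d)%N.
  by exists (size f); rewrite leq_addl.
elim: d => [|d IHd] in i le_d *.
  rewrite addn0 in le_d.
  by rewrite nth_default // polyC0 mul0r; exact: ideal0 idaX.
have high j : (i < j)%N -> divides a%:P ((f`_j)%:P * h).
  move=> lt_ij; apply: IHd; rewrite (leq_trans le_d) // addnS -addSn.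
  by rewrite leq_add2r.
(* In the coefficient of f h at i + m, terms with k < i vanish by degree and those with k > i are
   divisible by [high]. *)
have top : divides a (f`_i * h`_m).
  have /divides_polyC/(_ (i + m)%N) := afh.
  have lt_i : (i < (i + m).+1)%N by rewrite ltnS leq_addr.
  rewrite coefM (bigD1 (Ordinal lt_i)) //= addKn.
  set S := \sum_(_ < _ | _) _ => sumI.
  rewrite -[X in divides _ X](addrK S); apply: (ideal_sub ida) => //.
  rewrite /S; apply: (big_ind (divides a)) => [|x y|k neki].
      exact: (ideal0 ida).
    exact: (ideal_add ida).
  have [lt_ki|le_ik] := ltnP k i.
    rewrite [h`__]nth_default ?mulr0; first exact: (ideal0 ida).
    by rewrite eh ltn_subRL ltn_add2r.
  have /high/divides_polyC/(_ (i + m - k)%N) : (i < k)%N.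
    by rewrite ltn_neqAle le_ik andbT eq_sym.
  by rewrite coefCM.
pose h' := h - (h`_m)%:P * 'X^m.
have sh' : (size h' < size h)%N := size_sub_lead_term h0.
have topX : divides a%:P ((f`_i)%:P * ((h`_m)%:P * 'X^m)).
  rewrite mulrA -polyCM; apply: (ideal_mulr _ idaX).
  by have [r ->] := top; exists r%:P; rewrite polyCM.
suff fih' : divides a%:P ((f`_i)%:P * h').
  have -> : h = h' + (h`_m)%:P * 'X^m by rewrite subrK.
  by rewrite mulrDr; apply: (ideal_add idaX).
(* The outer induction applies to f_i h', which is shorter than [h] and whose product with [f] is
   still divisible by [a]. *)
apply: IHn.
  have := size_scale_leq f`_i h'; rewrite -mul_polyC => /leq_ltn_trans; apply.
  by rewrite (leq_trans sh') // -ltnS.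
rewrite mulrBr mulrBr; apply: (ideal_sub idaX).
  by rewrite mulrCA; exact: (ideal_mull _ idaX afh).
exact: (ideal_mull _ idaX topX).
Qed.

(** From p a = q h and p f = q k follows f h = a k; by McCoy [a] divides h, and cancelling [a] shows
    that q divides p. *)
Lemma gv_seq_const_poly (a : D) f : a != 0 ->
  (forall q p : D, q != 0 -> (forall i, divides q (p * f`_i)) -> divides q p) ->
  gv_seq [:: a%:P; f].
Proof.
move=> a0 f_reg; split; first by exists a%:P; rewrite ?mem_head ?polyC_eq0.
move=> q p q0 qp; have [h eh] := qp _ (mem_head _ _).
have [k ek] : divides q (p * f) by apply: qp; rewrite !inE eqxx orbT.
have [r er] : divides a%:P h.
  apply: (divides_mul_cancel (f := f)) => [b|]; first exact: f_reg.
  exists k; apply: (mulfI q0).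
  by rewrite mulrCA -eh mulrCA mulrA ek -mulrA [k * _]mulrC.
exists r; apply: (mulIf (x := a%:P)); first by rewrite polyC_eq0.
by rewrite eh er mulrA mulrAC.
Qed.

Definition content_ideal N : set D :=
  [set d | exists2 f, N f & exists i, d = f`_i].

Lemma ideal_content_ideal N : ideal N -> ideal (content_ideal N).
Proof.
move=> idN; apply/idealP; split.
  by exists 0; [exact: ideal0|exists 0%N; rewrite coef0].
move=> a _ _ [f Nf [i ->]] [g Ng [j ->]].
(* The shifts bring both coefficients to the index i + j. *)
exists (a%:P * 'X^j * f + 'X^i * g).
  by apply: (ideal_add idN); exact: ideal_mull.
exists (i + j)%N; rewrite coefD -mulrA coefCM !coefXnM.
by rewrite addnK addKn ltnNge leq_addl ltnNge leq_addr.
Qed.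

Lemma content_ideal_seq N (s : seq D) : ideal N ->
  (forall x, x \in s -> content_ideal N x) ->
  exists2 f, N f & forall x, x \in s -> exists i, x = f`_i.
Proof.
move=> idN; elim: s => [|x s IHs] sN; first by exists 0 => //; exact: ideal0.
have [f Nf sf] : exists2 f, N f & forall y, y \in s -> exists i, y = f`_i.
  by apply: IHs => y ys; apply: sN; rewrite inE ys orbT.
have [g Ng [j ej]] := sN _ (mem_head _ _).
(* Shifted past the end of [f], the coefficients of [g] do not interfere with those of [f]. *)
exists (f + 'X^(size f) * g).
  by apply: (ideal_add idN) => //; exact: ideal_mull.
move=> y; rewrite inE => /orP[/eqP->|/sf[i ei]].
  exists (size f + j)%N; rewrite coefD coefXnM ltnNge leq_addr /= addKn.
  by rewrite nth_default ?leq_addr // add0r.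
have [lt_i|le_i] := ltnP i (size f).
  by exists i; rewrite coefD coefXnM lt_i addr0.
(* Here the entry is 0, so any index beyond both polynomials will do. *)
exists (maxn (size f) 0 + size g)%N.
rewrite ei nth_default // maxn0 coefD coefXnM ltnNge leq_addr /= addKn.
by rewrite !nth_default ?leq_addr // add0r.
Qed.

(** If the content of [N] contained a GV-sequence, one [f] in [N] would carry it among its
    coefficients, and [a], [f] would be a GV-sequence inside [N]. So the content lies in some
    maximal w-ideal M, and [N] in M[X]. *)
Lemma w_Max_extension_of N : w_Max N -> (exists2 a, a != 0 & N a%:P) ->
  exists2 M, w_Max M & N = extension M.
Proof.
move=> maxN [a a0 Na]; have [[idN _ _] _ N_max] := maxN.
have avc : avoids_gv (content_ideal N).
  move=> s gv_s; apply: contrapT => nex.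
  have [|f Nf sf] := @content_ideal_seq N s idN.
    by move=> x xs; apply: contrapT => nx; apply: nex; exists x.
  have [|x] := w_Max_avoids_gv maxN (@gv_seq_const_poly a f a0 _).
    by move=> q p q0 qp; apply: gv_s.2 => // x /sf[i ->].
  by rewrite !inE => /orP[]/eqP->.
have ca : content_ideal N a by exists a%:P => //; exists 0%N; rewrite coefC.
have [|M [maxM primeM avM cM]] := sub_w_Max (ideal_content_ideal idN) _ avc.
  by move=> c0; move: ca; rewrite c0 => /eqP; rewrite (negPf a0).
have NM : N `<=` extension M.
  by move=> f Nf i; apply: cM; exists f => //; exists i.
exists M => //; apply: contrapT => neN.
apply: (N_max (extension M)); last by split=> // MN; exact/neN/seteqP.
  apply: prime_w_ideal; [exact: prime_extension| |exact: extension_avoids_gv].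
  move=> M0; have : extension M a%:P by exact: NM.
  by rewrite M0 => /eqP; rewrite polyC_eq0 (negPf a0).
move=> MT; have /prime_idealP[_ + _] := prime_extension primeM.
by rewrite MT; apply.
Qed.

(** A maximal w-ideal above M[X] contains a nonzero constant, so it is some M'[X]; contracting gives
    M inside M', hence equality. *)
Lemma w_Max_extension M : w_Max M -> w_Max (extension M).
Proof.
move=> maxM; have primeM := w_Max_prime maxM; have idM := prime_is_ideal primeM.
have [[_ M0 _] _ _] := maxM; have [a Ma a0] := nonzero_elt idM M0.
have Xa : extension M a%:P by move: Ma; rewrite -{1}(contraction_extension idM).
have [|N [maxN _ _ MN]] := sub_w_Max (ideal_extension idM) _
    (extension_avoids_gv primeM (w_Max_avoids_gv maxM)).
  by move=> X0; move: Xa; rewrite X0 => /eqP; rewrite polyC_eq0 (negPf a0).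
have [|M' maxM' eN] := w_Max_extension_of maxN.
  by exists a => //; exact: MN.
rewrite (w_Max_eq maxM maxM') -?eN // => d Md.
have idM' := prime_is_ideal (w_Max_prime maxM').
rewrite -(contraction_extension idM') -eN; apply: MN.
by move: Md; rewrite -{1}(contraction_extension idM).
Qed.

End MaximalWIdeals.

(** * Primes below M[X] when D[X] is w-Hilbert *)

Section WHilbertPolynomial.
Variable D : idomainType.
Hypothesis hilbert_DX : w_Hilbert {poly D}.
Implicit Types (M : set D) (N Q : set {poly D}) (f : {poly D}).

Lemma upper_to_zero_nsub_extension Q M : upper_to_zero Q -> w_Max M ->
  ~ Q `<=` extension M.
Proof.
move=> upQ maxM QM; have [primeQ Qn0 Q0] := upQ.
have wQ := prime_w_ideal primeQ Qn0 (upper_to_zero_avoids_gv upQ).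
have [S SMax QS] := hilbert_DX primeQ wQ.
(* Otherwise [Q] equals M[X], and contracting makes [M] zero. *)
have QnMax : ~ w_Max Q.
  move=> maxQ; have [[_ M0 _] _ _] := maxM; apply: M0.
  have idM := prime_is_ideal (w_Max_prime maxM).
  rewrite -(contraction_extension idM) -(w_Max_eq maxQ (w_Max_extension maxM) QM).
  apply/seteqP; split=> [d /Q0//|_ ->]; exact: ideal0 (prime_is_ideal primeQ).
have [f Qf f0] := nonzero_elt (prime_is_ideal primeQ) Qn0.
(* Each [N] in [S] turns out to be an extension, so it contains the coefficients of [f]; these are
   then constants in [Q], hence 0. *)
apply/negP: f0; apply/negPn/eqP/polyP => i; rewrite coef0; apply: Q0.
rewrite QS => N SN; have maxN := SMax _ SN.
have QN : Q `<=` N by rewrite QS => g; apply.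
have [[a a0 Na]|Nn0] := pselect (exists2 a, a != 0 & N a%:P); last first.
  case: QnMax; rewrite (upper_to_zero_eq primeQ Qn0 _ QN) //.
  have [[_ N0 _] _ _] := maxN; split; rewrite //; first exact: w_Max_prime.
  move=> d Nd; apply/eqP; apply: contrapT => /negP d0; apply: Nn0; by exists d.
have [M' maxM' eN] := w_Max_extension_of maxN (ex_intro2 _ _ a a0 Na).
have := QN _ Qf; rewrite eN => /(_ i) fi j; rewrite coefC; case: ifP => // _.
exact: ideal0 (prime_is_ideal (w_Max_prime maxM')).
Qed.

Lemma divides_const_mul_notin M f : w_Max M -> f != 0 ->
  exists d t, [/\ d != 0, ~ extension M t & divides f (d%:P * t)].
Proof.
move=> maxM f0; apply: contrapT => nex.
have primeXM := prime_extension (w_Max_prime maxM).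
have /prime_idealP[_ XM1 XM_prime] := primeXM.
pose G (s : seq {poly D}) :=
  (* The multiplicative set of the products d t, as singleton sequences. *)
  exists (d : D) t, [/\ d != 0, ~ extension M t & s = [:: d%:P * t]].
have [|s t [d [u [d0 Mu ->]]] [e [v [e0 Mv ->]]]|s [d [t [d0 Mt ->]]]|] :=
    @max_avoiding_prime _ G [set g | divides f g] _ _ (ideal_divides f).
- by exists 1, 1; rewrite oner_neq0 mulr1; split.
- exists (d * e), (u * v); split; first by rewrite mulf_neq0.
    by move=> /XM_prime[].
  by rewrite /= mulrACA polyCM.
- exists (d%:P * t); first by rewrite mem_head.
  by move=> fdt; apply: nex; exists d, t.
move=> Q [fQ primeQ avQ _].
have Qnot d t : d != 0 -> ~ extension M t -> ~ Q (d%:P * t).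
  move=> d0 Mt; have [|x] := avQ [:: d%:P * t]; first by exists d, t.
  by rewrite inE => /eqP->.
(* Taking t = 1 shows that [Q] meets D in 0, and d = 1 that [Q] lies in M[X]. *)
apply: (@upper_to_zero_nsub_extension Q M) => //.
  split=> // [Q0|d Qd].
    have : Q f by apply: fQ; exists 1; rewrite mulr1.
    by rewrite Q0 => /eqP; rewrite (negPf f0).
  by apply/eqP; apply: contrapT => /negP /Qnot/(_ XM1); rewrite mulr1; apply.
move=> g Qg; apply: contrapT => /(Qnot _ _ (oner_neq0 D)); apply.
by rewrite mul1r.
Qed.

Lemma prime_sub_extension Q M : w_Max M -> prime_ideal Q ->
  Q `<=` extension M -> extension (contraction Q) = Q.
Proof.
move=> maxM primeQ QM; have /prime_idealP[idQ Q1 Q_prime] := primeQ.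
apply/seteqP; split; first exact: extension_contraction.
move=> f1 Qf1; apply: contrapT => nf1.
have [f [Qf nf] minf] := @min_size _
  [set f | Q f /\ ~ extension (contraction Q) f] _ (conj Qf1 nf1).
have idXQ := ideal_extension (ideal_contraction idQ).
have f0 : f != 0 by apply/eqP => f0; apply: nf; rewrite f0; exact: ideal0.
set c := lead_coef f.
(* If c were in [Q], dropping the leading term of [f] would give a smaller counterexample. *)
have nQc : ~ Q c%:P.
  move=> Qc; set m := (size f).-1.
  have Qtop : Q (c%:P * 'X^m) by exact: ideal_mulr.
  have XQtop : extension (contraction Q) (c%:P * 'X^m).
    apply: (ideal_mulr _ idXQ) => i; rewrite coefC; case: ifP => // _.
    exact: (ideal0 idQ).
  suff : (size f <= size (f - c%:P * 'X^m)%R)%N.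
    by rewrite leqNgt size_sub_lead_term.
  apply: minf; split; first exact: ideal_sub.
  move=> XQ; apply: nf; rewrite -[f](subrK (c%:P * 'X^m)).
  exact: (ideal_add idXQ).
have [d [t [d0 Mt [k ek]]]] := divides_const_mul_notin maxM f0.
have := Pdiv.Idomain.divp_eq t f; rewrite -/c -mul_polyC.
set n := scalp t f; set r := (t %% f)%R; set q := (t %/ f)%R => eq_t.
(* Since d t = f k, also d r is a multiple of [f], yet it is shorter than [f]. *)
have r0 : r = 0.
  have er : d%:P * r = f * ((c ^+ n)%:P * k - d%:P * q).
    rewrite mulrBr (mulrCA f) -ek (mulrCA _ d%:P t) eq_t mulrDr.
    by rewrite (mulrCA f d%:P q) (mulrC f q) addrAC subrr add0r.
  apply/eqP; apply: contraT => rn0.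
  have : (size f <= size (d%:P * r)%R)%N.
    have : d%:P * r != 0 by rewrite mulf_neq0 ?polyC_eq0.
    rewrite er; set x := _ - _; rewrite mulf_eq0 negb_or => /andP[_ x0].
    rewrite size_mul // -subn1 leq_subRL ?addn_gt0 ?size_poly_gt0 ?f0 //.
    by rewrite addnC leq_add2l size_poly_gt0.
  by rewrite mul_polyC size_scale // leqNgt ltn_modpN0.
have : Q ((c ^+ n)%:P * t) by rewrite eq_t r0 addr0; exact: ideal_mull.
by move=> /Q_prime[|/QM//]; rewrite polyC_exp => /prime_exp-/(_ primeQ).
Qed.

Lemma extensionS (A B : set D) : A `<=` B -> extension A `<=` extension B.
Proof. by move=> AB f Af i; exact/AB/Af. Qed.

Lemma contractionS (A B : set {poly D}) : A `<=` B ->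
  contraction A `<=` contraction B.
Proof. by move=> AB d; exact: AB. Qed.

Lemma chain_sub (R : idomainType) (C : nat -> set R) n i :
  (forall j, (j < n)%N -> C j `<` C j.+1) -> (i <= n)%N -> C i `<=` C n.
Proof.
elim: n => [|n IHn] Cn; first by rewrite leqn0 => /eqP->.
rewrite leq_eqVlt => /orP[/eqP->//|lt_in].
have CnS := (Cn n (ltnSn n)).1; apply: subset_trans CnS; apply: IHn => // j lt_jn.
exact/Cn/(ltn_trans lt_jn).
Qed.

(** All terms of a chain ending at M[X] lie in M[X], so they are extensions and contracting them
    preserves strict inclusions. *)
Lemma prime_chain_extension M n : w_Max M ->
  prime_chain n (extension M) <-> prime_chain n M.
Proof.
move=> maxM; have idM := prime_is_ideal (w_Max_prime maxM).
split=> -[C [C_prime C_lt Cn]].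
  have CE i : (i <= n)%N -> extension (contraction (C i)) = C i.
    move=> le_in; apply: (prime_sub_extension maxM); first exact: C_prime.
    by rewrite -Cn; exact: chain_sub.
  exists (fun i => contraction (C i)); split=> [i /C_prime|i lt_in|/=].
  - exact: prime_contraction.
  - have [sub nsub] := C_lt i lt_in; split; first exact: contractionS.
    move=> /extensionS; rewrite !CE //; exact: ltnW.
  - by rewrite Cn contraction_extension.
have idC i : (i <= n)%N -> ideal (C i) by move=> /C_prime; exact: prime_is_ideal.
exists (fun i => extension (C i)); split=> [i /C_prime|i lt_in|/=].
- exact: prime_extension.
- have [sub nsub] := C_lt i lt_in; split; first exact: extensionS.
  move=> /contractionS; rewrite !contraction_extension //; apply: idC => //.
  exact: ltnW.
- by rewrite Cn.
Qed.

Lemma height_extension M : w_Max M -> height (extension M) = height M.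
Proof.
move=> maxM; rewrite /height; congr (supremum _ [set _ | _ in _]).
apply/seteqP; by split=> n /prime_chain_extension; apply.
Qed.

(** [C 1] is nonzero, hence equal to [N], which leaves no room for [C 2]. *)
Lemma upper_to_zero_chain N n : upper_to_zero N -> prime_chain n N -> (n <= 1)%N.
Proof.
move=> upN [C [C_prime C_lt Cn]]; rewrite leqNgt; apply/negP => lt_1n.
have le_1n := ltnW lt_1n.
have C1N : C 1%N `<=` N by rewrite -Cn; exact: chain_sub.
have C2N : C 2%N `<=` N by rewrite -Cn; exact: chain_sub.
have C10 : C 1%N <> [set 0].
  move=> C10; have [_] := C_lt 0%N le_1n; apply; rewrite C10 => _ ->.
  exact: ideal0 (prime_is_ideal (C_prime _ (leq0n n))).
have [_] := C_lt 1%N lt_1n; apply.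
by rewrite (upper_to_zero_eq (C_prime _ le_1n) C10 upN C1N).
Qed.

End WHilbertPolynomial.

(** * Suprema, heights and the comparison of w-dimensions *)

(** Needed because [supremum] picks a least upper bound only if one exists: the maximum for bounded
    [A], and +oo otherwise. *)
Lemma supremums_nat (A : set nat) : A !=set0 ->
  supremums [set n%:Z%:E | n in A] !=set0.
Proof.
move=> [a Aa]; have [[b Ab]|unb] := pselect (exists b, ubound A b).
  have ex : exists n, `[< A n >] by exists a; apply/asboolP.
  have bd n : `[< A n >] -> (n <= b)%N by move=> /asboolP/Ab.
  case: (ex_maxnP ex bd) => m /asboolP Am max_m.
  exists m%:Z%:E; split=> [_ [n An <-]|x]; last by apply; exists m.
  by rewrite lee_fin lez_nat; apply/max_m/asboolP.
exists +oo%E; split=> [x _|x xub]; first exact: leey.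
case: x xub => [z|//|] xub; exfalso; last first.
  by have := xub a%:Z%:E (ex_intro2 _ _ a Aa erefl).
apply: unb; exists `|z|%N => n An.
have := xub n%:Z%:E (ex_intro2 _ _ n An erefl); rewrite lee_fin => le_nz.
by rewrite leEnat -lez_nat (le_trans le_nz) // ler_norm.
Qed.

Lemma height_supremums (R : idomainType) (P : set R) : prime_ideal P ->
  supremums [set n%:Z%:E | n in [set n | prime_chain n P]] (height P).
Proof.
move=> primeP; rewrite /height /supremum.
have chain0 : prime_chain 0 P by exists (fun=> P).
have ne : [set n | prime_chain n P] !=set0 by exists 0%N.
case: eqP => [e|_]; last by have [x] := supremums_nat ne; exact: xgetI.
have : [set n%:Z%:E | n in [set n | prime_chain n P]] 0%:Z%:E by exists 0%N.
by rewrite e.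
Qed.

Lemma prime_set0 (R : idomainType) : prime_ideal ([set 0] : set R).
Proof.
apply/prime_idealP; split; first exact: ideal_set0.
  by move=> /eqP; rewrite oner_eq0.
by move=> u v /eqP; rewrite mulf_eq0 => /orP[]/eqP; [left|right].
Qed.

Lemma height_ge1 (R : idomainType) (P : set R) :
  prime_ideal P -> P <> [set 0] -> (1%:Z%:E <= height P)%E.
Proof.
move=> primeP Pn0; have idP := prime_is_ideal primeP.
have [+ _] := height_supremums primeP; apply; exists 1%N => //.
exists (fun i => if i is 0%N then [set 0] else P); split=> // [[|i] _|[|//] _] //.
- exact: prime_set0.
- split=> [_ ->|P0]; first exact: ideal0.
  by apply: Pn0; apply/seteqP; split=> // _ ->; exact: ideal0.
Qed.

(** For a nonzero nonunit [a], a GV-sequence inside the ideal of multiples of [a] would make [a]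
    divide 1. *)
Lemma exists_w_Max (R : idomainType) : ~ GRing.field_axiom R ->
  exists M : set R, w_Max M.
Proof.
move=> /existsNP[a /not_implyP[a0 a_nunit]].
have aI := ideal_divides a.
have aa : [set p | divides a p] a by exists 1; rewrite mulr1.
have [||M [maxM _ _ _]] := sub_w_Max aI; last by exists M.
  by move=> I0; move: aa; rewrite I0 => /eqP; rewrite (negPf a0).
move=> s gv_s; apply: contrapT => nex; apply: a_nunit.
have [r er] : divides a 1.
  apply: gv_s.2 => // x xs; rewrite mul1r.
  by apply: contrapT => nax; apply: nex; exists x.
by apply/unitrPr; exists r.
Qed.

(** Fields are excluded: over a field [w_Max D] is empty and [w_dim D] is 0, while D[X] is a
    w-Hilbert principal ideal domain of w-dimension 1. *)
Theorem corollary3p6 (D : idomainType) (D_not_field : ~ GRing.field_axiom D)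
  (hilbert_DX : w_Hilbert {poly D}) :
  w_dim D = w_dim {poly D}.
Proof.
have [M0 maxM0] := exists_w_Max D_not_field.
(* The supremum of a nonempty set depends only on its upper bounds. *)
have ub_eq : ubound [set height M | M in @w_Max D] =
    ubound [set height N | N in @w_Max {poly D}].
  apply/seteqP; split=> x xub _ [N maxN <-]; last first.
    apply: xub; exists (extension N); first exact: w_Max_extension.
    exact: height_extension.
  have [[a a0 Na]|Nn0] := pselect (exists2 a, a != 0 & N a%:P).
    have [M maxM ->] := w_Max_extension_of maxN (ex_intro2 _ _ a a0 Na).
    by rewrite height_extension //; apply: xub; exists M.
  have upN : upper_to_zero N.
    have [[_ N0 _] _ _] := maxN; split=> //; first exact: w_Max_prime.
    move=> d Nd; apply/eqP; apply: contrapT => /negP d0; apply: Nn0.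
    by exists d.
  (* An upper to zero has height at most 1, which [M0] already attains. *)
  apply: (@le_trans _ _ 1%:Z%:E).
    have [_] := height_supremums (w_Max_prime maxN); apply=> _ [n nN <-].
    by rewrite lee_fin lez_nat; exact: upper_to_zero_chain nN.
  apply: (@le_trans _ _ (height M0)); last by apply: xub; exists M0.
  by apply: height_ge1; [exact: w_Max_prime|case: maxM0 => -[]].
rewrite /w_dim /supremum /supremums ub_eq.
(* Both sets are nonempty, so neither supremum takes the default 0 of the empty set. *)
have htM0 : [set height M | M in @w_Max D] (height M0) by exists M0.
have htXM0 : [set height N | N in @w_Max {poly D}] (height (extension M0)).
  by exists (extension M0) => //; exact: w_Max_extension.
case: eqP => [e|_]; first by rewrite e in htM0.
by case: eqP => [e|_] //; rewrite e in htXM0.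
Qed.
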